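(* Let $n \ge 2$ be an integer, let $k$ be a subfield of $\mathbb{R}$, and let $\mathbf{a},\mathbf{b} \in k^n$ be linearly independent vectors. (1) The following conditions are equivalent: (A1) One of the angle bisectors between two intersecting lines with direction vectors $\mathbf{a}$ and $\mathbf{b}$ has a direction vector $\mathbf{c} \in k^n$. (A2) One of the angle bisectors between two hyperplanes with normal vectors $\mathbf{a}$ and $\mathbf{b}$ has a normal vector $\mathbf{c} \in k^n$. (A3) There exists a vector $\mathbf{c} \in k^n$ such that $\langle \mathbf{a},\mathbf{c}\rangle^2 |\mathbf{b}|^2 = \langle \mathbf{b},\mathbf{c}\rangle^2 |\mathbf{a}|^2$. (A4) $|\mathbf{a}|^2 \equiv |\mathbf{b}|^2 \pmod{k^{\times 2}}$. Moreover, if (A4) holds, then the vector $\mathbf{c}$ in (A1)–(A3) can be taken to be $\mathbf{c} = \mathbf{a} \pm \frac{|\mathbf{a}|}{|\mathbf{b}|}\mathbf{b}$. (2) Suppose moreover that $k/\mathbb{Q}$ is algebraic, and $\mathbf{a} = (a_1,\dots,a_n)$, $\mathbf{b} = (b_1,\dots,b_n) \in O_k^{\,n}$. Then the following conditions are equivalent: (B1) One of the angle bisectors between two intersecting lines with direction vectors $\mathbf{a}$ and $\mathbf{b}$ has a direction vector $\mathbf{c} \in O_k^{\,n}$. (B2) One of the angle bisectors between two hyperplanes with normal vectors $\mathbf{a}$ and $\mathbf{b}$ has a normal vector $\mathbf{c} \in O_k^{\,n}$. (B3) There exists a vector $\mathbf{c} \in O_k^{\,n}$ such that $\langle \mathbf{a},\mathbf{c}\rangle^2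 |\mathbf{b}|^2 = \langle \mathbf{b},\mathbf{c}\rangle^2 |\mathbf{a}|^2$. (B4) There exist $a_{n+1}, b_{n+1}, d \in O_k$ with $d > 0$ such that both $(x_1,\dots,x_n,x_{n+1}) = (a_1,\dots,a_n,a_{n+1})$ and $(x_1,\dots,x_n,x_{n+1}) = (b_1,\dots,b_n,b_{n+1})$ are solutions of $\sum_{i=1}^n x_i^2 = d\,x_{n+1}^2$. Moreover, if (B4) holds, then the vector $\mathbf{c}$ in (B1)–(B3) can be taken to be $\mathbf{c} = b_{n+1}\mathbf{a} \pm a_{n+1}\mathbf{b}$.
   Context: $\langle\cdot,\cdot\rangle$ is the standard inner product on $\mathbb{R}^n$ and $|\cdot|$ the Euclidean norm. $k^{\times 2} = \{q^2 : q \in k^\times\}$; for $x,y \in k^\times$, $x \equiv y \pmod{k^{\times 2}}$ means $x/y \in k^{\times 2}$. When $k/\mathbb{Q}$ is algebraic, $O_k$ denotes the ring of algebraic integers of $k$. Given two lines, both angles formed by them are considered (acute or not); an angle bisector of two hyperplanes is a hyperplane bisecting one of the angles between them.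
   Formalization: In (A3)/(B3) c must not be orthogonal to both a and b (c = 0 would always work); in (B4) d is taken in k, and d in O_k is equivalent only if O_k is Bezout (false e.g. for k = Q(√10), a = (1,2), b = (1,1)); (B4) ⇒ (B1)–(B3) holds for every k. *)

(* Defs.v *)
From HB Require Import structures.
From mathcomp Require Import all_boot all_order all_algebra.
From mathcomp Require Import all_classical all_reals all_analysis.
Set Implicit Arguments.
Unset Strict Implicit.
Unset Printing Implicit Defensive.
Import Order.TTheory GRing.Theory Num.Theory.
Local Open Scope classical_set_scope.
Local Open Scope ring_scope.

Section Euclidean.
Variables (R : realType) (n : nat).
Implicit Types (u v w p : 'rV[R]_n) (L H : set 'rV[R]_n).

Definition dot u v : R := \sum_(i < n) u ord0 i * v ord0 i.

(* The library's `|u| on row vectors is the sup norm. *)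
Definition enorm u : R := Num.sqrt (dot u u).

(* Unoriented angle, in [0, pi], between the rays spanned by u and v. *)
Definition angle u v : R := acos (dot u v / (enorm u * enorm v)).

Definition line p u : set 'rV[R]_n := [set p + t *: u | t in [set: R]].

Definition has_direction L u : Prop := u != 0 /\ exists p, L = line p u.

Definition hyperplane u (h : R) : set 'rV[R]_n := [set x | dot u x = h].

Definition has_normal H u : Prop := u != 0 /\ exists h, H = hyperplane u h.

(* The ray along w lies in the sector spanned by the rays along u and v, and
   makes equal angles with its two sides. *)
Definition bisecting_ray u v w : Prop :=
  [/\ w != 0,
      exists s t : R, [/\ 0 <= s, 0 <= t & w = s *: u + t *: v]
    & angle u w = angle w v].

(* L bisects one of the angles formed by the lines L1 and L2 meeting at the
   single point p. As u and v may be replaced by their opposites, all the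
   angles at p are taken into account, acute or not. *)
Definition line_bisector L1 L2 L : Prop :=
  exists p u v w,
    [/\ L1 `&` L2 = [set p] /\ L p,
        has_direction L1 u, has_direction L2 v, has_direction L w
      & bisecting_ray u v w].

(* The affine subspace through p normal to E. *)
Definition normal_section (E : set 'rV[R]_n) p : set 'rV[R]_n :=
  [set x | forall y, E y -> dot (x - p) (y - p) = 0].

(* The dihedral angles between H1 and H2 are the plane angles cut out on the
   plane normal to the edge H1 `&` H2 at a point p of it; H bisects one of
   them when it contains the edge and its trace on that plane bisects the
   corresponding plane angle. *)
Definition hyperplane_bisector H1 H2 H : Prop :=
  [/\ exists c, has_normal H c,
      H1 `&` H2 `<=` H
    & exists2 p, (H1 `&` H2) p &
        let P := normal_section (H1 `&` H2) p in
        line_bisector (H1 `&` P) (H2 `&` P) (H `&` P)].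

Definition line_bisector_direction L1 L2 c : Prop :=
  exists2 L, line_bisector L1 L2 L & has_direction L c.

Definition hyperplane_bisector_normal H1 H2 c : Prop :=
  exists2 H, hyperplane_bisector H1 H2 H & has_normal H c.

(* A vector c orthogonal to both a and b (such as 0) turns the equation into
   0 = 0 whatever a and b are; these degenerate solutions are excluded. *)
Definition bisecting_equation a b c : Prop :=
  dot a c ^+ 2 * enorm b ^+ 2 = dot b c ^+ 2 * enorm a ^+ 2
  /\ ~ (dot a c = 0 /\ dot b c = 0).

Definition coords_in (S : set R) u : Prop := forall i, S (u ord0 i).

(* (u, z) is a solution of x_1^2 + ... + x_n^2 = d x_(n+1)^2. *)
Definition on_quadric (d : R) u (z : R) : Prop :=
  \sum_(i < n) u ord0 i ^+ 2 = d * z ^+ 2.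

(* Common solvability, with last coordinates in O and coefficient in D. Over
   the ring of integers O of a field k whose class group is not trivial, it
   matters whether d is sought in O or in k: in k = Q(sqrt 10), the vectors
   b = (1, 1, 0, 0, 0, 0) and a = (5 + s, 5 + s, 11, 3, 2, 1), where
   s = sqrt 10, satisfy |a|^2 / |b|^2 = ((20 + s) / 2)^2, but d can only be
   found outside O. *)
Definition common_quadric (O D : set R) a b : Prop :=
  exists za zb d : R,
    [/\ O za, O zb, D d & 0 < d] /\ (on_quadric d a za /\ on_quadric d b zb).

End Euclidean.

Section Arithmetic.
Variables (R : realType) (k : divringClosed R).

Definition subfield_set : set R := [set x | x \in k].

Definition eqmod_squares (x y : R) : Prop :=
  exists q : R, [/\ q \in k, q != 0 & x / y = q ^+ 2].

Definition algebraic_over_Q : Prop :=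
  forall x : R, x \in k -> algebraicOver (ratr : rat -> R) x.

Definition ring_of_integers : set R :=
  [set x | x \in k /\ integralOver (intr : int -> R) x].

End Arithmetic.

(* Any two elements of the subring O generate a principal ideal; for the ring
   of integers of a number field, this means class number one. *)
Definition bezout (R : realType) (O : set R) : Prop :=
  forall x y, O x -> O y ->
    exists u v s t, [/\ O u, O v, O s & O t] /\
      (x = s * (u * x + v * y) /\ y = t * (u * x + v * y)).

(* Main.v *)
Require Import Defs.
From mathcomp Require Import all_boot all_order all_algebra.
From mathcomp Require Import all_classical all_reals all_analysis.
From mathcomp Require Import ring lra.
Set Implicit Arguments.
Unset Strict Implicit.
Unset Printing Implicit Defensive.
Import Order.TTheory GRing.Theory Num.Theory.
Local Open Scope classical_set_scope.
Local Open Scope ring_scope.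

(* A vector c = x a + y b bisects an angle between the lines along a and b when
   x a and y b have equal lengths. For c in the plane of a and b this is
   equivalent to <a,c>^2 |b|^2 = <b,c>^2 |a|^2, because the difference of the two
   sides is (x^2 |a|^2 - y^2 |b|^2) (|a|^2 |b|^2 - <a,b>^2). A quarter turn of
   that plane exchanges normal vectors of hyperplanes and directions of their
   traces, so bisectors of hyperplanes reduce to bisectors of lines. Finally,
   the equation makes |a|^2 / |b|^2 the square of <a,c> / <b,c>, and conversely a
   square root of |a|^2 / |b|^2 gives the coefficients x and y. *)

(** * Inner product, Cauchy-Schwarz inequality and angles *)

Section InnerProduct.
Variables (R : realType) (n : nat).
Implicit Types u v w : 'rV[R]_n.

Lemma dotC u v : dot u v = dot v u.
Proof. by apply: eq_bigr => i _; rewrite mulrC. Qed.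

Lemma dotDr u v w : dot u (v + w) = dot u v + dot u w.
Proof. by rewrite -big_split; apply: eq_bigr => i _; rewrite mxE mulrDr. Qed.

Lemma dotZr t u v : dot u (t *: v) = t * dot u v.
Proof. by rewrite mulr_sumr; apply: eq_bigr => i _; rewrite mxE mulrCA. Qed.

Lemma dotNr u v : dot u (- v) = - dot u v.
Proof. by rewrite -scaleN1r dotZr mulN1r. Qed.

Lemma dotDl u v w : dot (v + w) u = dot v u + dot w u.
Proof. by rewrite dotC dotDr !(dotC u). Qed.

Lemma dotZl t u v : dot (t *: v) u = t * dot v u.
Proof. by rewrite dotC dotZr (dotC u). Qed.

Lemma dotNl u v : dot (- v) u = - dot v u.
Proof. by rewrite dotC dotNr (dotC u). Qed.

Lemma dot0r u : dot u 0 = 0.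
Proof. by rewrite -(scale0r 0) dotZr mul0r. Qed.

Lemma dot0l u : dot 0 u = 0.
Proof. by rewrite dotC dot0r. Qed.

Definition dotE := (dotDr, dotDl, dotNr, dotNl, dotZr, dotZl).

Lemma dot_ge0 u : 0 <= dot u u.
Proof. by apply: sumr_ge0 => i _; rewrite -expr2 sqr_ge0. Qed.

Lemma dot_eq0 u : (dot u u == 0) = (u == 0).
Proof.
apply/eqP/eqP => [u0|->]; last exact: dot0r.
apply/rowP => i; rewrite mxE; apply/eqP; rewrite -sqrf_eq0 expr2; apply/eqP.
have /psumr_eq0P h : \sum_(i < n) u ord0 i * u ord0 i = 0 by [].
by apply: h => // j _; rewrite -expr2 sqr_ge0.
Qed.

Lemma dot_gt0 u : (0 < dot u u) = (u != 0).
Proof. by rewrite lt0r dot_ge0 andbT dot_eq0. Qed.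

Lemma enorm_sqr u : enorm u ^+ 2 = dot u u.
Proof. by rewrite sqr_sqrtr ?dot_ge0. Qed.

Lemma enorm_gt0 u : (0 < enorm u) = (u != 0).
Proof. by rewrite sqrtr_gt0 dot_gt0. Qed.

(** Cauchy-Schwarz: for nonzero [u], the squared length of |u|^2 v - <u,v> u is |u|^2 times this
    quantity. *)
Lemma dot_gram_ge0 u v : 0 <= dot u u * dot v v - dot u v ^+ 2.
Proof.
have [->|u0] := eqVneq u 0.
  by rewrite !dot0l expr0n mul0r subr0.
rewrite -(pmulr_rge0 _ (_ : 0 < dot u u)) ?dot_gt0//.
have := dot_ge0 (dot u u *: v - dot u v *: u).
rewrite !dotE (dotC v u); congr (0 <= _); ring.
Qed.

Lemma dot_cos_itv u v : u != 0 -> v != 0 ->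
  dot u v / (enorm u * enorm v) \in `[-1, 1].
Proof.
move=> u0 v0; have uv : 0 < enorm u * enorm v by rewrite mulr_gt0 ?enorm_gt0.
rewrite in_itv /= -ler_norml normrM normfV (gtr0_norm uv) ler_pdivrMr // mul1r.
rewrite -(@ler_pXn2r _ 2) ?nnegrE ?normr_ge0 ?(ltW uv) // real_normK ?num_real //.
by rewrite exprMn !enorm_sqr -subr_ge0 dot_gram_ge0.
Qed.

(** Taking cosines and clearing denominators gives <u,w> |v| = <v,w> |u|; squaring then removes the
    square roots hidden in the norms. *)
Lemma angle_eq_sqr u v w : u != 0 -> v != 0 -> w != 0 ->
  angle u w = angle w v -> dot u w ^+ 2 * dot v v = dot v w ^+ 2 * dot u u.
Proof.
move=> u0 v0 w0 /(congr1 (@cos R)).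
rewrite !acosK ?dot_cos_itv // => h.
rewrite -!enorm_sqr -!exprMn (dotC v); congr (_ ^+ 2).
have := enorm_gt0 u; have := enorm_gt0 v; have := enorm_gt0 w.
rewrite u0 v0 w0 => w1 v1 u1.
move: h => /(congr1 ( *%R^~ (enorm u * enorm v * enorm w))).
have -> : dot u w / (enorm u * enorm w) * (enorm u * enorm v * enorm w)
  = dot u w * enorm v by field; rewrite !gt_eqF.
by move=> ->; field; rewrite !gt_eqF.
Qed.

End InnerProduct.

(** * Bisectors of two lines *)

Section Lines.
Variables (R : realType) (n : nat).
Implicit Types (a b c p u v w : 'rV[R]_n) (L : set 'rV[R]_n).

(** The Gram determinant, that is, the squared area of the parallelogram on [a] and [b]. *)
Definition gram a b : R := dot a a * dot b b - dot a b ^+ 2.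

Definition indep a b : Prop :=
  forall x y : R, x *: a + y *: b = 0 -> x = 0 /\ y = 0.

(* The vectors x a and y b then have equal lengths, and c is a diagonal of the
   rhombus that they span. *)
Definition bisects a b c : Prop :=
  exists x y : R,
    [/\ c = x *: a + y *: b, c != 0 & x ^+ 2 * dot a a = y ^+ 2 * dot b b].

Lemma free_indep a b : free [:: a; b] -> indep a b.
Proof.
rewrite -[X in free X]/(tval [tuple a; b]) => /freeP h x y xy.
have := h (fun i => [:: x; y]`_i); rewrite !big_ord_recl big_ord0 /= addr0.
by move=> /(_ xy) h'; split; [exact: (h' ord0) | exact: (h' ord_max)].
Qed.

Lemma indep_neq0 a b : indep a b -> a != 0 /\ b != 0.
Proof.
move=> h; split; apply/eqP => e.
  by have [] := h 1 0 _ => [|/eqP]; rewrite ?e ?scaler0 ?scale0r ?addr0 ?oner_eq0.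
by have [] := h 0 1 _ => [|_ /eqP]; rewrite ?e ?scaler0 ?scale0r ?addr0 ?oner_eq0.
Qed.

(** Equality in Cauchy-Schwarz would make |a|^2 b - <a,b> a vanish, a linear relation in which [b]
    has the nonzero coefficient |a|^2. *)
Lemma gram_gt0 a b : indep a b -> 0 < gram a b.
Proof.
move=> h; have [a0 b0] := indep_neq0 h.
rewrite lt0r dot_gram_ge0 andbT; apply/eqP => g0.
have : dot a a *: b - dot a b *: a = 0.
  apply/eqP; rewrite -dot_eq0 !dotE (dotC b a); apply/eqP.
  transitivity (dot a a * gram a b); first by rewrite /gram; ring.
  by rewrite g0 mulr0.
rewrite addrC -scaleNr => /h[_ /eqP].
by rewrite dot_eq0 (negPf a0).
Qed.

Lemma bisects_dot a b x y (c := x *: a + y *: b) :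
  dot a c ^+ 2 * dot b b - dot b c ^+ 2 * dot a a
  = (x ^+ 2 * dot a a - y ^+ 2 * dot b b) * gram a b.
Proof. by rewrite /c !dotE (dotC b a) /gram; ring. Qed.

Lemma span_eq0 a b x y (c := x *: a + y *: b) :
  dot a c = 0 -> dot b c = 0 -> c = 0.
Proof.
move=> h1 h2; apply/eqP; rewrite -dot_eq0.
have -> : dot c c = x * dot a c + y * dot b c by rewrite -!dotZl -dotDl.
by rewrite h1 h2 !mulr0 addr0.
Qed.

Lemma span_not_orthogonal a b c x y : c != 0 -> c = x *: a + y *: b ->
  ~ (dot a c = 0 /\ dot b c = 0).
Proof.
by move=> c0 cE [h1 h2]; move: c0 h1 h2; rewrite cE => /eqP c0 /span_eq0 h /h.
Qed.

Lemma bisects_equation a b c :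
  indep a b -> bisects a b c -> bisecting_equation a b c.
Proof.
move=> h [x [y [cE c0 xy]]]; split; last exact: span_not_orthogonal cE.
by rewrite cE !enorm_sqr; apply/eqP; rewrite -subr_eq0 bisects_dot xy subrr mul0r.
Qed.

Lemma bisects_span a b c x y : indep a b -> c != 0 -> c = x *: a + y *: b ->
  dot a c ^+ 2 * dot b b = dot b c ^+ 2 * dot a a -> bisects a b c.
Proof.
move=> h c0 cE /eqP; rewrite -subr_eq0 {1 2}cE bisects_dot mulf_eq0 subr_eq0.
by rewrite (gt_eqF (gram_gt0 h)) orbF => /eqP xy; exists x, y.
Qed.

Lemma lineZ p u t : t != 0 -> line p (t *: u) = line p u.
Proof.
move=> t0; apply/seteqP; split=> _ [s _ <-] /=.
  by exists (s * t) => //; rewrite scalerA.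
by exists (s / t) => //; rewrite scalerA divfK.
Qed.

Lemma line_move p q u : line p u q -> line p u = line q u.
Proof.
move=> [t _ <-]; apply/seteqP; split=> _ [s _ <-] /=.
  by exists (s - t) => //; rewrite -addrA -scalerDl [t + _]addrC subrK.
by exists (t + s) => //; rewrite scalerDl addrA.
Qed.

Lemma has_direction_line p u : u != 0 -> has_direction (line p u) u.
Proof. by move=> u0; split=> //; exists p. Qed.

Lemma directionP L p u : has_direction L u -> L p -> L = line p u.
Proof. by move=> [_ [q ->]]; exact: line_move. Qed.

Lemma direction_unique L u v : has_direction L u -> has_direction L v ->
  exists2 t, t != 0 & u = t *: v.
Proof.
move=> [u0 [p LE]] Lv; have Lp : L p by rewrite LE; exists 0; rewrite // scale0r addr0.
have : L (p + u) by rewrite LE; exists 1; rewrite // scale1r.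
rewrite (directionP Lv Lp) => -[t _ /addrI tv]; exists t => //.
by apply: contra_neq u0 => t0; rewrite -tv t0 scale0r.
Qed.

Lemma line_cap a b p : indep a b -> line p a `&` line p b = [set p].
Proof.
move=> h; apply/seteqP; split=> [_ [[s _ <-] [t _ /addrI /eqP]]|_ ->].
  rewrite eq_sym -subr_eq0 -scaleNr => /eqP /h[-> _].
  by rewrite /= scale0r addr0.
by split; exists 0; rewrite // scale0r addr0.
Qed.

(** The direction vectors hidden in [line_bisector] are nonzero multiples of [a], [b] and [c]. The
    squared angle equation is homogeneous in each of them, so the factors cancel. *)
Lemma line_bisector_bisects L1 L2 L a b c : indep a b ->
  has_direction L1 a -> has_direction L2 b -> has_direction L c ->
  line_bisector L1 L2 L -> bisects a b c.
Proof.
move=> h L1a L2b Lc [p [u [v [w [_ L1u L2v Lw]]]]].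
case=> w0 [s [t [_ _ wE]]] ang.
have := angle_eq_sqr L1u.1 L2v.1 w0 ang.
have [al al0 uE] := direction_unique L1u L1a.
have [be be0 vE] := direction_unique L2v L2b.
have [ga ga0 wc] := direction_unique Lw Lc.
rewrite uE vE wc !dotE => eq.
(* These coefficients come from solving ga c = s (al a) + t (be b) for [c]. *)
apply: (bisects_span (x := ga^-1 * (s * al)) (y := ga^-1 * (t * be)) h Lc.1).
  by rewrite -!scalerA -scalerDr -uE -vE -wE wc scalerA mulVf ?scale1r.
have k0 : (al * be * ga) ^+ 2 != 0 by rewrite expf_neq0 ?mulf_neq0.
by apply: (mulfI k0); move: eq; lra.
Qed.

(** The signs of [x] and [y] select the angle: the rays along x a and y b have [c] as the sum of
    their direction vectors, and these have equal lengths. *)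
Lemma bisects_line_bisector p a b c : indep a b -> bisects a b c ->
  line_bisector (line p a) (line p b) (line p c).
Proof.
move=> h [x [y [cE c0 xy]]]; have [a0 b0] := indep_neq0 h.
have daa : 0 < dot a a by rewrite dot_gt0.
have dbb : 0 < dot b b by rewrite dot_gt0.
(* The coefficients can only vanish together, which c != 0 forbids, so x a and y b do direct the two
   lines. *)
have xy0 : (x == 0) = (y == 0).
  apply/eqP/eqP => e; move: xy; rewrite e expr0n mul0r => /eqP.
    by rewrite eq_sym mulf_eq0 (gt_eqF dbb) orbF sqrf_eq0 => /eqP.
  by rewrite mulf_eq0 (gt_eqF daa) orbF sqrf_eq0 => /eqP.
have x0 : x != 0.
  apply: contra_neq c0 => x0; have := xy0.
  by rewrite cE x0 eqxx => /esym/eqP ->; rewrite !scale0r addr0.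
have y0 : y != 0 by rewrite -xy0.
exists p, (x *: a), (y *: b), c; split.
- by rewrite line_cap //; split=> //; exists 0; rewrite // scale0r addr0.
- rewrite -(lineZ _ _ x0); apply: has_direction_line.
  by rewrite scaler_eq0 negb_or x0.
- rewrite -(lineZ _ _ y0); apply: has_direction_line.
  by rewrite scaler_eq0 negb_or y0.
- exact: has_direction_line.
split=> //; first by exists 1, 1; rewrite !scale1r !ler01.
have nE : enorm (x *: a) = enorm (y *: b).
  by rewrite /enorm !dotE !mulrA -!expr2 xy.
rewrite /angle nE [enorm c * _]mulrC; congr (acos (_ / _)).
(* The numerators <xa, c> and <c, yb> differ by |xa|^2 - |yb|^2 = 0. *)
by rewrite cE !dotE; move: xy; lra.
Qed.

End Lines.

(** * Bisectors of two hyperplanes, reduced to lines in a normal plane *)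

Section Hyperplanes.
Variables (R : realType) (n : nat) (a b : 'rV[R]_n).
Hypothesis ab_indep : indep a b.
Implicit Types (c p u v w : 'rV[R]_n) (H : set 'rV[R]_n).

(* On the plane spanned by a and b this is the rotation by a right angle scaled
   by the area of the parallelogram on a and b. It sends the normal vector of a
   hyperplane to the direction of its trace on that plane. *)
Definition turn u : 'rV[R]_n := dot a u *: b - dot b u *: a.

Lemma turnD x y u v : turn (x *: u + y *: v) = x *: turn u + y *: turn v.
Proof.
rewrite /turn !dotE !scalerDl !scalerBr !scalerA opprD.
by rewrite addrACA.
Qed.

Lemma dot_turn_l : dot (turn a) (turn a) = gram a b * dot a a.
Proof. by rewrite /turn !dotE (dotC b a) /gram; ring. Qed.

Lemma dot_turn_r : dot (turn b) (turn b) = gram a b * dot b b.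
Proof. by rewrite /turn !dotE (dotC b a) /gram; ring. Qed.

Lemma turn_eq0 u : turn u = 0 -> dot a u = 0 /\ dot b u = 0.
Proof.
rewrite /turn addrC -scaleNr => /ab_indep[/eqP]; rewrite oppr_eq0 => /eqP ->.
by move=> ->.
Qed.

Lemma turn_span_eq0 x y : turn (x *: a + y *: b) = 0 -> x = 0 /\ y = 0.
Proof. by move=> /turn_eq0[? ?]; apply: ab_indep; exact: span_eq0. Qed.

Lemma turn_indep : indep (turn a) (turn b).
Proof. by move=> x y; rewrite -turnD; exact: turn_span_eq0. Qed.

(** Cramer's rule for the Gram matrix of [a] and [b]. *)
Lemma span_solve (h1 h2 : R) : exists x y,
  dot a (x *: a + y *: b) = h1 /\ dot b (x *: a + y *: b) = h2.
Proof.
have := gt_eqF (gram_gt0 ab_indep) => /negbT; rewrite /gram => g0.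
exists ((h1 * dot b b - h2 * dot a b) / gram a b).
exists ((h2 * dot a a - h1 * dot a b) / gram a b).
by rewrite !dotE (dotC b a) /gram; split; field.
Qed.

Lemma span_residual u : exists x y,
  let r := u - (x *: a + y *: b) in dot a r = 0 /\ dot b r = 0.
Proof.
have [x [y [h1 h2]]] := span_solve (dot a u) (dot b u).
by exists x, y; rewrite /= !(dotDr _ u) !dotNr h1 h2 !subrr.
Qed.

Lemma dot_span_eq0 u x y :
  dot a u = 0 -> dot b u = 0 -> dot (x *: a + y *: b) u = 0.
Proof. by move=> h1 h2; rewrite !dotE h1 h2 !mulr0 addr0. Qed.

(** The residual of [u] is orthogonal to [a] and [b], hence to [u] by hypothesis, hence to
    itself. *)
Lemma orthogonal_span u :
  (forall r, dot a r = 0 -> dot b r = 0 -> dot u r = 0) ->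
  exists x y, u = x *: a + y *: b.
Proof.
move=> h; have [x [y []]] := span_residual u.
set r := u - _ => r1 r2; exists x, y; apply/eqP; rewrite -subr_eq0 -dot_eq0.
by rewrite -/r {1}/r dotDl dotNl h // dot_span_eq0 // subr0.
Qed.

Lemma not_orthogonal_l : ~ (dot a a = 0 /\ dot b a = 0).
Proof. by case=> /eqP; rewrite dot_eq0 (negPf (indep_neq0 ab_indep).1). Qed.

Lemma not_orthogonal_r : ~ (dot a b = 0 /\ dot b b = 0).
Proof. by case=> _ /eqP; rewrite dot_eq0 (negPf (indep_neq0 ab_indep).2). Qed.

Section Edge.
Variables (h1 h2 : R) (p : 'rV[R]_n).
Let E := hyperplane a h1 `&` hyperplane b h2.
Hypothesis Ep : E p.

Lemma edge_add r : dot a r = 0 -> dot b r = 0 -> E (p + r).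
Proof.
by case: Ep => e1 e2 r1 r2; split; rewrite /hyperplane /= dotDr ?r1 ?r2 addr0.
Qed.

(** The differences y - p with [y] on the edge are exactly the vectors orthogonal to [a] and [b],
    and the double orthogonal of the span is the span itself. *)
Lemma normal_sectionE :
  normal_section E p = [set x | exists s t, x = p + (s *: a + t *: b)].
Proof.
apply/seteqP; split=> [x|_ [s [t ->]] y Ey] /=.
  move=> hx; have [s [t e]] : exists s t, x - p = s *: a + t *: b.
    apply: orthogonal_span => r r1 r2.
    by have := hx _ (edge_add r1 r2); rewrite [p + r]addrC addrK.
  by exists s, t; rewrite -e addrC subrK.
rewrite [p + _]addrC addrK; case: Ey Ep => e1 e2 [e3 e4].
by apply: dot_span_eq0; rewrite dotDr dotNr ?e1 ?e2 ?e3 ?e4 subrr.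
Qed.

(** At p + s a + t b the equation of the hyperplane reads s <a,c> + t <b,c> = 0. So (s, t) is
    proportional to (-<b,c>, <a,c>), the coefficients of [turn c]. *)
Lemma trace_line c h : hyperplane c h p -> ~ (dot a c = 0 /\ dot b c = 0) ->
  hyperplane c h `&` normal_section E p = line p (turn c).
Proof.
move=> <- hc; rewrite normal_sectionE; apply/seteqP; split=> [x [] /=|_ [t _ <-]].
  move=> cx [s [t xE]]; move: cx; rewrite xE /hyperplane /= dotDr => /eqP.
  rewrite -subr_eq0 [dot c p + _]addrC addrK !dotE (dotC c a) (dotC c b) => /eqP st.
  (* The factor of proportionality is found by dividing by whichever of <a,c>, <b,c> is nonzero. *)
  have [a0|a0] := eqVneq (dot a c) 0.
    have b0 : dot b c != 0 by apply/eqP => b0; apply: hc.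
    exists (- s / dot b c) => //; rewrite /turn a0 scale0r sub0r scalerN scalerA.
    move: st; rewrite a0 mulr0 add0r => /eqP.
    rewrite mulf_eq0 (negPf b0) orbF => /eqP ->; rewrite scale0r addr0.
    by rewrite divfK // scaleNr opprK.
  exists (t / dot a c) => //; congr (_ + _).
  rewrite /turn scalerBr !scalerA divfK // addrC; congr (_ + _).
  rewrite -scaleNr; congr (_ *: _); apply: (mulIf a0).
  transitivity (- (t * dot b c)); first by field.
  by apply/eqP; rewrite eq_sym -subr_eq0 opprK st.
split; last by exists (- (t * dot b c)), (t * dot a c);
  rewrite /turn scalerBr !scalerA scaleNr [_ *: b - _]addrC.
by rewrite /hyperplane /= dotDr /turn !dotE (dotC c a) (dotC c b); ring.
Qed.

End Edge.

(** Containing the edge puts [c] in the span of [a] and [b]. The traces on the normal plane are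
    directed by the turned vectors, and the result on lines is carried back through [turn],
    injective on that span. *)
Lemma hyperplane_bisects H1 H2 c : has_normal H1 a -> has_normal H2 b ->
  hyperplane_bisector_normal H1 H2 c -> bisects a b c.
Proof.
move=> [a0 [h1 ->]] [b0 [h2 ->]] [H [_ EH [p Ep]]].
move=> lb [c0 [h HE]]; rewrite HE in EH lb.
have hE : h = dot c p by rewrite -(EH _ Ep).
(* For [r] orthogonal to [a] and [b], the point p + r stays on the edge, hence in [H], so [c] is
   orthogonal to [r]. *)
have [x [y cE]] : exists x y, c = x *: a + y *: b.
  apply: orthogonal_span => r r1 r2.
  have := EH _ (edge_add Ep r1 r2); rewrite /hyperplane /= dotDr hE => /eqP.
  by rewrite -subr_eq0 [dot c p + _]addrC addrK => /eqP.
have nc := span_not_orthogonal c0 cE.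
have [e1 e2] := Ep.
move: lb; rewrite /= (trace_line Ep e1 not_orthogonal_l).
rewrite (trace_line Ep e2 not_orthogonal_r) (trace_line Ep (esym hE) nc).
have dir u : ~ (dot a u = 0 /\ dot b u = 0) ->
    has_direction (line p (turn u)) (turn u).
  by move=> nu; apply: has_direction_line; apply/eqP => /turn_eq0.
move=> /(line_bisector_bisects turn_indep (dir _ not_orthogonal_l)
  (dir _ not_orthogonal_r) (dir _ nc)).
case=> s [t [tE _]].
have [es et] : x - s = 0 /\ y - t = 0.
  apply: turn_span_eq0; rewrite turnD !scalerBl addrACA -opprD -turnD -cE tE.
  by rewrite subrr.
(* Turning multiplies both squared lengths by the same nonzero [gram a b], which cancels. *)
rewrite dot_turn_l dot_turn_r !mulrA -![_ * gram a b]mulrC -!mulrA.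
move=> /(mulfI (negbT (gt_eqF (gram_gt0 ab_indep)))) st.
exists x, y; split=> //.
by rewrite (subr0_eq es) (subr0_eq et) !expr2 -!mulrA.
Qed.

Lemma bisects_hyperplane H1 H2 c : has_normal H1 a -> has_normal H2 b ->
  bisects a b c -> hyperplane_bisector_normal H1 H2 c.
Proof.
move=> [a0 [h1 ->]] [b0 [h2 ->]] bc; have [x [y [cE c0 xy]]] := bc.
(* Independence of the normals makes the hyperplanes meet; the base point of the edge is sought in
   the span of [a] and [b]. *)
have [s [t [e1 e2]]] := span_solve h1 h2.
set p := s *: a + t *: b in e1 e2.
have Ep : (hyperplane a h1 `&` hyperplane b h2) p by [].
have Hc : has_normal (hyperplane c (dot c p)) c by split=> //; exists (dot c p).
exists (hyperplane c (dot c p)) => //; split; first by exists c.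
  move=> z [z1 z2]; rewrite /hyperplane /= cE !(dotDl _ (x *: a)) !dotZl.
  by rewrite z1 z2 e1 e2.
have nc := span_not_orthogonal c0 cE.
exists p => //=; rewrite (trace_line Ep e1 not_orthogonal_l).
rewrite (trace_line Ep e2 not_orthogonal_r) (trace_line Ep (erefl _) nc).
apply: bisects_line_bisector; first exact: turn_indep.
exists x, y; split; first by rewrite cE turnD.
  by apply/eqP => /turn_eq0.
by rewrite dot_turn_l dot_turn_r ![gram a b * _]mulrC !mulrA xy.
Qed.

End Hyperplanes.

(** * Square classes, integrality and the quadric *)

Section Arithmetic.
Variables (R : realType) (n : nat) (k : divringClosed R).
Implicit Types (a b c : 'rV[R]_n).

Local Notation O := (ring_of_integers k).

Lemma dot_subfield a b : coords_in (subfield_set k) a ->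
  coords_in (subfield_set k) b -> dot a b \in k.
Proof.
by move=> ka kb; apply: rpred_sum => i _; apply: rpredM; [exact: ka | exact: kb].
Qed.

Lemma integers_add x y : O x -> O y -> O (x + y).
Proof. by move=> [? ?] [? ?]; split; [exact: rpredD | exact: integral_add]. Qed.

Lemma integers_mul x y : O x -> O y -> O (x * y).
Proof. by move=> [? ?] [? ?]; split; [exact: rpredM | exact: integral_mul]. Qed.

Lemma integers0 : O 0.
Proof. by split; [exact: rpred0 | exact: mxpoly.integral0]. Qed.

Lemma integers_sign (e : bool) x : O x -> O ((-1) ^+ e * x).
Proof.
move=> [? ?]; split; first by rewrite rpredMsign.
by case: e; rewrite ?mulN1r ?mul1r //; exact: integral_opp.
Qed.

(** [x] is a root of the monic polynomial X^2 - x^2, whose coefficients are integral. *)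
Lemma integers_sqr x : x \in k -> O (x ^+ 2) -> O x.
Proof.
move=> kx [_ ox]; split=> //.
apply: (@integral_root_monic _ _ _ x ('X^2 - (x ^+ 2)%:P)).
- exact: monicXnsubC.
- by rewrite /root !hornerE subrr.
apply/integral_poly => i; rewrite coefB coefXn coefC.
by apply: integral_sub; [exact: integral_nat | case: ifP => // _; exact: mxpoly.integral0].
Qed.

Lemma integers_dot a b : coords_in O a -> coords_in O b -> O (dot a b).
Proof.
move=> oa ob; apply: (big_ind O) => [||i _]; first exact: integers0.
  exact: integers_add.
exact: (integers_mul (oa i) (ob i)).
Qed.

Lemma on_quadricE d a z : on_quadric d a z <-> dot a a = d * z ^+ 2.
Proof.
by rewrite /on_quadric /dot; under eq_bigr do rewrite expr2.
Qed.

(** As [a] and [b] are nonzero, the equation makes <a,c> and <b,c> vanish together, which the second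
    half of [bisecting_equation] excludes. *)
Lemma equation_dot a b c : bisecting_equation a b c -> a != 0 -> b != 0 ->
  [/\ dot a c != 0, dot b c != 0
    & dot a c ^+ 2 * dot b b = dot b c ^+ 2 * dot a a].
Proof.
rewrite /bisecting_equation !enorm_sqr => -[eq nz] a0 b0.
split=> //; apply/eqP => z; apply: nz; split=> //; apply/eqP; move: eq.
  move/eqP; rewrite z expr0n mul0r eq_sym mulf_eq0 sqrf_eq0 dot_eq0 (negPf a0).
  by rewrite orbF.
by move/eqP; rewrite z expr0n mul0r mulf_eq0 sqrf_eq0 dot_eq0 (negPf b0) orbF.
Qed.

(** The square root of |a|^2 / |b|^2 in [k] is <a,c> / <b,c>. *)
Lemma equation_eqmod a b c : a != 0 -> b != 0 ->
  coords_in (subfield_set k) a -> coords_in (subfield_set k) b ->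
  coords_in (subfield_set k) c -> bisecting_equation a b c ->
  eqmod_squares k (enorm a ^+ 2) (enorm b ^+ 2).
Proof.
move=> a0 b0 ka kb kc /equation_dot[] // ac bc eq.
exists (dot a c / dot b c); rewrite !enorm_sqr; split.
- by apply: rpred_div; exact: dot_subfield.
- by rewrite mulf_neq0 ?invr_eq0.
have bb : dot b b != 0 by rewrite dot_eq0.
apply: (mulIf bb); rewrite divfK // exprMn exprVn mulrAC eq mulrAC divff ?mul1r //.
by rewrite expf_neq0.
Qed.

(** The last coordinates are <a,c> and <b,c>, which are integral; [d] is then forced to be |a|^2 /
    <a,c>^2, a quotient known only to lie in [k]. *)
Lemma equation_quadric a b c : a != 0 -> b != 0 ->
  coords_in O a -> coords_in O b -> coords_in O c ->
  bisecting_equation a b c -> common_quadric O (subfield_set k) a b.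
Proof.
move=> a0 b0 oa ob oc /equation_dot[] // ac bc eq.
have ac2 : dot a c ^+ 2 != 0 by rewrite expf_neq0.
exists (dot a c), (dot b c), (dot a a / dot a c ^+ 2).
split; last split; first split.
- exact: integers_dot.
- exact: integers_dot.
- by apply: rpred_div; last apply: rpredX; exact: (integers_dot _ _).1.
- by rewrite divr_gt0 ?dot_gt0 // exprn_even_gt0.
- by apply/on_quadricE; rewrite divfK.
- by apply/on_quadricE; apply: (mulfI ac2); rewrite eq; field.
Qed.

(* With g = gcd(za, zb) = u za + v zb, za = s g and zb = t g, the coefficient
   d' = d g^2 is again integral: d' s^2 = |a|^2 and d' t^2 = |b|^2 are integral,
   hence so is d' s t, whose square is their product, and u s + v t = 1 gives
   d' = u^2 |a|^2 + v^2 |b|^2 + 2 u v d' s t. *)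
Lemma bezout_quadric a b : a != 0 -> coords_in O a -> coords_in O b ->
  bezout O -> common_quadric O (subfield_set k) a b -> common_quadric O O a b.
Proof.
move=> a0 oa ob hO [za [zb [d [[oza ozb kd d0] [/on_quadricE qa /on_quadricE qb]]]]].
have [u [v [s [t [[ou ov os ot] []]]]]] := hO _ _ oza ozb.
set g := u * za + v * zb => sE tE.
have za0 : za != 0.
  by apply: contra_neq a0 => z0; apply/eqP; rewrite -dot_eq0 qa z0 expr0n mulr0.
have g0 : g != 0 by apply: contra_neq za0 => g0; rewrite sE g0 mulr0.
have uv : u * s + v * t = 1.
  by apply: (mulIf g0); rewrite mul1r mulrDl -!mulrA -sE -tE.
have og : O g by apply: integers_add; exact: integers_mul.
have kd' : d * g ^+ 2 \in k by apply: rpredM; [exact: kd | apply: rpredX; exact: og.1].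
have aE : dot a a = d * g ^+ 2 * s ^+ 2 by rewrite qa sE; ring.
have bE : dot b b = d * g ^+ 2 * t ^+ 2 by rewrite qb tE; ring.
set d' := d * g ^+ 2 in kd' aE bE.
have ost : O (d' * (s * t)).
  apply: integers_sqr; first by apply: rpredM => //; exact: (integers_mul os ot).1.
  have -> : (d' * (s * t)) ^+ 2 = dot a a * dot b b by rewrite aE bE; ring.
  by apply: integers_mul; exact: integers_dot.
have od : O d'.
  have -> : d' = u * u * dot a a + (v * v * dot b b
      + (u * v * (d' * (s * t)) + u * v * (d' * (s * t)))).
    transitivity (d' * (u * s + v * t) ^+ 2); first by rewrite uv expr1n mulr1.
    by rewrite aE bE; ring.
  by do !apply: integers_add;
     repeat first [exact: ost | exact: integers_dot | by [] | apply: integers_mul].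
exists s, t, d'; split; first split=> //.
  by rewrite mulr_gt0 // exprn_even_gt0.
by split; apply/on_quadricE.
Qed.

End Arithmetic.

Theorem theorem1p4 (R : realType) (n : nat) (k : divringClosed R)
    (a b : 'rV[R]_n) (L1 L2 H1 H2 : set 'rV[R]_n)
    (hn : (2 <= n)%N)
    (ka : coords_in (subfield_set k) a) (kb : coords_in (subfield_set k) b)
    (hab : free [:: a; b])
    (hL1 : has_direction L1 a) (hL2 : has_direction L2 b)
    (hL : L1 `&` L2 !=set0)
    (hH1 : has_normal H1 a) (hH2 : has_normal H2 b) :
  ( [<-> exists2 c, coords_in (subfield_set k) c & line_bisector_direction L1 L2 c;
         exists2 c, coords_in (subfield_set k) c &
           hyperplane_bisector_normal H1 H2 c;
         exists2 c, coords_in (subfield_set k) c & bisecting_equation a b c;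
         eqmod_squares k (enorm a ^+ 2) (enorm b ^+ 2)]
    /\
    ( eqmod_squares k (enorm a ^+ 2) (enorm b ^+ 2) ->
      forall e : bool,
      let c := a + ((-1) ^+ e * (enorm a / enorm b)) *: b in
      [/\ coords_in (subfield_set k) c, line_bisector_direction L1 L2 c,
          hyperplane_bisector_normal H1 H2 c & bisecting_equation a b c] ) )
  /\
  ( let O := ring_of_integers k in
    algebraic_over_Q k -> coords_in O a -> coords_in O b ->
    [/\ [<-> exists2 c, coords_in O c & line_bisector_direction L1 L2 c;
             exists2 c, coords_in O c & hyperplane_bisector_normal H1 H2 c;
             exists2 c, coords_in O c & bisecting_equation a b c;
             common_quadric O (subfield_set k) a b],
        bezout O ->
        [<-> exists2 c, coords_in O c & line_bisector_direction L1 L2 c;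
             exists2 c, coords_in O c & hyperplane_bisector_normal H1 H2 c;
             exists2 c, coords_in O c & bisecting_equation a b c;
             common_quadric O O a b]
      & forall za zb d : R,
        O za -> O zb -> subfield_set k d -> 0 < d ->
        on_quadric d a za -> on_quadric d b zb ->
        forall e : bool,
        let c := zb *: a + ((-1) ^+ e * za) *: b in
        [/\ coords_in O c, line_bisector_direction L1 L2 c,
            hyperplane_bisector_normal H1 H2 c & bisecting_equation a b c]] ).
Proof.
have hI := free_indep hab; have [a0 b0] := indep_neq0 hI.
have line_bis c : line_bisector_direction L1 L2 c -> bisects a b c.
  by case=> L LB Lc; exact: line_bisector_bisects LB.
have bis_line c : bisects a b c -> line_bisector_direction L1 L2 c.
  case: hL => p [L1p L2p] bc; exists (line p c).
    by rewrite (directionP hL1 L1p) (directionP hL2 L2p); exact: bisects_line_bisector.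
  by apply: has_direction_line; case: bc => x [y []].
have hyp_bis c : hyperplane_bisector_normal H1 H2 c -> bisects a b c.
  exact: (hyperplane_bisects hI hH1 hH2).
have bis_all (S : set R) c : coords_in S c -> bisects a b c ->
    [/\ coords_in S c, line_bisector_direction L1 L2 c,
        hyperplane_bisector_normal H1 H2 c & bisecting_equation a b c].
  move=> Sc bc; split=> //; first exact: bis_line.
    exact: (bisects_hyperplane hI hH1 hH2 bc).
  exact: (bisects_equation hI bc).
have line_hyp (S : set R) : (exists2 c, coords_in S c & line_bisector_direction L1 L2 c) ->
    exists2 c, coords_in S c & hyperplane_bisector_normal H1 H2 c.
  by case=> c Sc /line_bis bc; exists c => //; exact: (bisects_hyperplane hI hH1 hH2 bc).
have hyp_eq (S : set R) : (exists2 c, coords_in S c & hyperplane_bisector_normal H1 H2 c) ->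
    exists2 c, coords_in S c & bisecting_equation a b c.
  by case=> c Sc /hyp_bis bc; exists c => //; exact: (bisects_equation hI bc).
have bisI x y : x != 0 -> x ^+ 2 * dot a a = y ^+ 2 * dot b b ->
    bisects a b (x *: a + y *: b).
  by move=> x0 xy; exists x, y; split=> //; apply: contra_neq x0 => /hI[].
have squares_bis : eqmod_squares k (enorm a ^+ 2) (enorm b ^+ 2) -> forall e : bool,
    let c := a + ((-1) ^+ e * (enorm a / enorm b)) *: b in
    [/\ coords_in (subfield_set k) c, line_bisector_direction L1 L2 c,
        hyperplane_bisector_normal H1 H2 c & bisecting_equation a b c].
  move=> [q [kq q0 qE]] e c; apply: bis_all.
    (* Only the square of this ratio is known to be q^2, so the ratio is [q] or its opposite. *)
    have kr : enorm a / enorm b \in k.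
      move: qE; rewrite -expr_div_n => /eqP; rewrite eqf_sqr.
      by case/orP=> /eqP ->; rewrite ?rpredN.
    move=> i; rewrite !mxE; apply: rpredD; first exact: ka.
    by apply: rpredM; [rewrite rpredMsign | exact: kb].
  (* The factor |a| / |b| rescales [b] to the length of [a]; the sign chooses between the two
     bisectors. *)
  have := bisI 1 ((-1) ^+ e * (enorm a / enorm b)); rewrite scale1r; apply.
    exact: oner_neq0.
  rewrite exprMn sqrr_sign !expr_div_n !enorm_sqr expr1n !mul1r divfK //.
  by rewrite dot_eq0.
split.
  split=> //; tfae; [exact: line_hyp | exact: hyp_eq | |].
    by case=> c kc; exact: equation_eqmod.
  by move/squares_bis/(_ false) => [kc lc _ _]; eexists; [exact: kc | exact: lc].
move=> O _ oa ob.
have quadric_bis za zb d : O za -> O zb -> subfield_set k d -> 0 < d ->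
    on_quadric d a za -> on_quadric d b zb -> forall e : bool,
    let c := zb *: a + ((-1) ^+ e * za) *: b in
    [/\ coords_in O c, line_bisector_direction L1 L2 c,
        hyperplane_bisector_normal H1 H2 c & bisecting_equation a b c].
  move=> oza ozb kd d0 /on_quadricE qa /on_quadricE qb e c; apply: bis_all.
    move=> i; rewrite !mxE; apply: integers_add; apply: integers_mul => //;
      [exact: oa | exact: integers_sign | exact: ob].
  (* Both squared lengths equal d za^2 zb^2. The coefficient [zb] is nonzero, since otherwise |b|^2
     = d zb^2 would vanish. *)
  apply: bisI; last by rewrite exprMn sqrr_sign qa qb; ring.
  by apply: contra_neq b0 => z0; apply/eqP; rewrite -dot_eq0 qb z0 expr0n mulr0.
have quadric_line : common_quadric O (subfield_set k) a b ->
    exists2 c, coords_in O c & line_bisector_direction L1 L2 c.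
  move=> [za [zb [d [[oza ozb kd d0] [qa qb]]]]].
  have [oc lc _ _] := quadric_bis _ _ _ oza ozb kd d0 qa qb false.
  by eexists; [exact: oc | exact: lc].
split=> [|hO|]; last exact: quadric_bis.
  tfae; [exact: line_hyp | exact: hyp_eq | | exact: quadric_line].
  by case=> c oc; exact: equation_quadric.
tfae; [exact: line_hyp | exact: hyp_eq | |].
  (* The equation yields a coefficient in [k]; dividing out the gcd of the last coordinates makes it
     integral. *)
  by case=> c oc /equation_quadric h; apply: bezout_quadric => //; exact: h.
move=> [za [zb [d [[oza ozb od d0] q]]]]; apply: quadric_line.
by exists za, zb, d; split=> //; split=> //; exact: od.1.
Qed.
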